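(* Let $d\ge1$, $\sigma_0>0$ and $W_*\in\mathbb{R}^{d\times d}$. Consider the quadratic network $f_W(x)=\sum_{i=1}^d(w_i^Tx)^2=x^TW^TWx=\langle W^TW,xx^T\rangle$ with weight matrix $W\in\mathbb{R}^{d\times d}$ (rows $w_i$), labels $y(x)=x^TW_*^TW_*x$, inputs $x\sim\mathcal N(0,I_d)$, initialization satisfying $W(0)^TW(0)=\sigma_0I$, trained by gradient flow $\dot W=-\nabla_W\ell_{var}(W)$ on the variance loss $$\ell_{var}(W)=\frac1{16}\mathbb{E}_x\big[(y(x)-f_W(x))^2\big]-\frac1{16}\big(\mathbb{E}_x[y(x)-f_W(x)]\big)^2.$$ Then $W^TW$ and $W_*^TW_*$ remain simultaneously diagonalized by a fixed orthogonal matrix and $$\dot\sigma_i(t)=\sigma_i(t)(\sigma_i^*-\sigma_i(t)),$$ where $\sigma_i$ and $\sigma_i^*$ are the $i$th eigenvalues (singular values) of $W^TW$ and $W_*^TW_*$ respectively, corresponding to the same eigenvector.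
   Context: $\langle X,Y\rangle=\mathrm{tr}(X^TY)$. Gradient flow means $W(t)$ solves $\dot W=-\nabla_W\ell_{var}(W)$ in continuous time. *)

(* Defs.v *)
From HB Require Import structures.
From mathcomp Require Import all_boot all_order all_algebra.
From mathcomp Require Import all_classical all_reals all_analysis.
Set Implicit Arguments. Unset Strict Implicit. Unset Printing Implicit Defensive.
Import Order.TTheory GRing.Theory Num.Theory.
Import numFieldNormedType.Exports.
Local Open Scope classical_set_scope.
Local Open Scope ring_scope.

(* Expectation of g(x_0,...,x_{n-1}) for x_0,...,x_{n-1} i.i.d. N(0,1),
   computed as iterated integrals against the standard normal probability
   measure (x_0 is integrated outermost). *)
Fixpoint gaussE_nat {R : realType} (n : nat) (g : (nat -> R) -> R) : R :=
  match n with
  | 0 => g (fun _ => 0)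
  | n'.+1 => Rintegral (normal_prob (0:R) 1) setT
      (fun t : R => gaussE_nat n' (fun x => g (fun k => if k is k'.+1 then x k' else t)))
  end.

Definition gaussE {R : realType} (d : nat) (g : 'cV[R]_d -> R) : R :=
  gaussE_nat d (fun x => g (\col_(i < d) x (nat_of_ord i))).

Definition fnet {R : realType} (d : nat) (W : 'M[R]_d) (x : 'cV[R]_d) : R :=
  \sum_(i < d) ((row i W) *m x) 0 0 ^+ 2.

Definition label {R : realType} (d : nat) (Wstar : 'M[R]_d) (x : 'cV[R]_d) : R :=
  ((x^T *m Wstar^T *m Wstar *m x) 0 0).

Definition lvar {R : realType} (d : nat) (Wstar : 'M[R]_d) (W : 'M[R]_d) : R :=
  (1 / 16) * gaussE (fun x => (label Wstar x - fnet W x) ^+ 2)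
  - (1 / 16) * (gaussE (fun x => label Wstar x - fnet W x)) ^+ 2.

Definition is_grad {R : realType} (d : nat) (f : 'M[R]_d -> R) (W G : 'M[R]_d) : Prop :=
  differentiable f W /\ forall V : 'M[R]_d, 'd f W V = \tr (G^T *m V).

Definition grad_flow {R : realType} (d : nat) (f : 'M[R]_d -> R) (W : R -> 'M[R]_d) : Prop :=
  (forall t : R, 0 < t -> exists G : 'M[R]_d, is_grad f (W t) G /\ is_derive t 1 W (- G))
  /\ (W x @[x --> (0:R)^'+] --> W 0).

(* Main.v *)
Require Import Defs.
From HB Require Import structures.
From mathcomp Require Import all_boot all_order all_algebra.
From mathcomp Require Import all_classical all_reals all_analysis.
From mathcomp Require Import measurable_realfun complex.
From mathcomp Require Import ring lra zify.
Set Implicit Arguments.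
Unset Strict Implicit.
Import Order.TTheory GRing.Theory Num.Theory.
Import numFieldNormedType.Exports.
Local Open Scope classical_set_scope.
Local Open Scope ring_scope.

(* By Wick's formula the variance of the quadratic form x^T D x under a standard
   Gaussian is 2 tr(D^2) for symmetric D.  With M = W^T W, M* = W*^T W* and
   D = M* - M this gives the loss tr(D^2) / 8, whose gradient in W is -W D / 2, so
   that the flow induces M' = (D M + M D) / 2.  In an orthonormal eigenbasis of M*
   this reads N' = a N + N a - N^2 with a diagonal.  If E is diagonal then
   C = E N - N E satisfies the linear equation C' = (a - N) C + C (a - N), and
   C(0) = 0 because N(0) is scalar; by Gronwall C = 0.  For E with distinct
   diagonal entries this says that N stays diagonal, and the diagonal entries of
   the equation for N are the claimed logistic equations. *)

(** * Orthogonal diagonalization of real symmetric matrices *)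

(** Over [R[i]] the matrix is Hermitian, so the spectral theorem supplies an eigenvalue lying in
    [R]. Being a root of the characteristic polynomial, which has coefficients in [R], it is an
    eigenvalue of [S] itself. *)
Lemma symmetric_eigenvalue (R : rcfType) n (S : 'M[R]_n.+1) :
  S^T = S -> exists a, eigenvalue S a.
Proof.
move=> symS; pose phi : {rmorphism R -> R[i]} := complex.real_complex R.
pose A := map_mx phi S.
have hA : A \is hermsymmx.
  apply: realsym_hermsym.
    by apply/is_hermitianmxP; rewrite expr0 scale1r map_mx_id // map_trmx symS.
  by apply/mxOverP => i j; rewrite mxE; apply/complex_realP; exists (S i j).
have /mxOverP/(_ 0 0)/complex_realP[a Da] := hermitian_spectral_diag_real hA.
have /hermitian_normalmx/orthomx_spectralP eA := hA.
have : eigenvalue A (spectral_diag A 0 0).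
  apply/eigenvalueP; exists (row 0 (spectralmx A)).
    rewrite {2}eA !mulmxA -row_mul mulmxV ?spectral_unit// row1.
    by rewrite -rowE row_diag_mx -scalemxAl -rowE.
  apply: contraTneq (spectral_unit A) => r0.
  rewrite unitmxE unitfE negbK (expand_det_row _ 0) big1// => j _.
  by move/rowP/(_ j): r0; rewrite !mxE => ->; rewrite mul0r.
rewrite Da -[(a%:C)%C]/(phi a) eigenvalue_root_char -map_char_poly fmorph_root.
by rewrite -eigenvalue_root_char; exists a.
Qed.

(** Reflection in the hyperplane orthogonal to [v - e] exchanges the unit vectors [e] and [v]. It
    serves to rotate a unit eigenvector onto the first coordinate axis. *)
Lemma householder_reflection (R : rcfType) n (v : 'rV[R]_n.+1) :
  v *m v^T = 1%:M -> exists H, [/\ H^T = H, H *m H = 1%:M & delta_mx 0 0 *m H = v].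
Proof.
move=> v1; pose e : 'rV[R]_n.+1 := delta_mx 0 0.
have ee : e *m e^T = 1%:M.
  apply/matrixP => i j; rewrite !ord1 -rowE !mxE !eqxx /=; lra.
have [->|ve] := eqVneq v e.
  by exists 1%:M; rewrite trmx1 !mulmx1.
pose w := v - e; pose v0 := v 0 0.
have ev : e *m v^T = v0%:M.
  by apply/matrixP => i j; rewrite !ord1 -rowE !mxE eqxx mulr1n.
have ve' : v *m e^T = v0%:M by rewrite -[LHS]trmxK trmx_mul trmxK ev tr_scalar_mx.
have ww : w *m w^T = (2 - 2 * v0)%:M.
  rewrite /w linearB /= mulmxBl !mulmxBr v1 ve' ev ee -!raddfB /=.
  by congr (_%:M); ring.
(* This is the squared length of [w]; if it vanished, so would every entry of [v - e]. *)
have w0 : 2 - 2 * v0 != 0.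
  apply: contraNneq ve => z; rewrite -subr_eq0 -/w; apply/eqP/rowP => j.
  have /matrixP/(_ 0 0) := ww; rewrite z !mxE eqxx mulr1n => /eqP.
  rewrite psumr_eq0 => [/allP/(_ j)|k _]; last by rewrite !mxE -expr2 sqr_ge0.
  rewrite mem_index_enum => /(_ isT)/implyP/(_ isT).
  by rewrite [w^T _ _]mxE mulf_eq0 orbb => /eqP; rewrite !mxE.
have ew : e *m w^T = (v0 - 1)%:M.
  by rewrite /w linearB /= mulmxBr ev ee -raddfB.
have wE : v = w + e by rewrite subrK.
clearbody w.
(* The reflection coefficient, 2 over the squared length of [w]. *)
pose c := 2 / (2 - 2 * v0).
exists (1%:M - c *: (w^T *m w)); split.
- by rewrite linearB /= linearZ /= trmx_mul trmxK trmx1.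
- have XX : w^T *m w *m (w^T *m w) = (2 - 2 * v0) *: (w^T *m w).
    by rewrite mulmxA -(mulmxA w^T w w^T) ww mul_mx_scalar -scalemxAl.
  rewrite mulmxBl !mulmxBr !mul1mx mulmx1 -scalemxAl -scalemxAr XX !scalerA.
  have -> : c * c * (2 - 2 * v0) = c + c by rewrite /c; field.
  by rewrite scalerDl opprB addrK subrK.
- rewrite mulmxBr mulmx1 -scalemxAr mulmxA -/e.
  rewrite ew mul_scalar_mx scalerA.
  have -> : c * (v0 - 1) = -1 by rewrite /c; field.
  by rewrite scaleN1r opprK wE addrC.
Qed.

(** Deflation: a Householder reflection moves a unit eigenvector to the first axis. By symmetry the
    conjugated matrix then splits into a 1 by 1 block and a smaller symmetric block, to which the
    induction applies. *)
Lemma symmetric_diagonalizable (R : rcfType) n (S : 'M[R]_n) : S^T = S ->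
  exists Q : 'M[R]_n, Q^T *m Q = 1%:M /\ is_diag_mx (Q^T *m S *m Q).
Proof.
elim: n S => [|n IH] S symS.
  by exists 1%:M; rewrite trmx1 mulmx1; split=> //; apply/is_diag_mxP; case.
have [a /eigenvalueP[u uS u0]] := symmetric_eigenvalue symS.
have nu : 0 < (u *m u^T) 0 0.
  rewrite mxE lt_neqAle eq_sym psumr_neq0; last first.
    by move=> k _; rewrite !mxE -expr2 sqr_ge0.
  rewrite sumr_ge0; last by move=> k _; rewrite !mxE -expr2 sqr_ge0.
  rewrite andbT; have /rV0Pn[j uj] := u0.
  apply/hasP; exists j; rewrite ?mem_index_enum //= [u^T _ _]mxE -expr2.
  by rewrite exprn_even_gt0.
pose v := (Num.sqrt ((u *m u^T) 0 0))^-1 *: u.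
have v1 : v *m v^T = 1%:M.
  rewrite /v linearZ /= -scalemxAl -scalemxAr scalerA.
  apply/matrixP => i j; rewrite !ord1 mxE -expr2 exprVn sqr_sqrtr ?ltW//.
  by rewrite mulVf ?gt_eqF// mxE eqxx.
have vS : v *m S = a *: v by rewrite /v -scalemxAl uS !scalerA mulrC.
have [H [symH HH eH]] := householder_reflection v1.
pose S' : 'M[R]_(1 + n) := H *m S *m H.
have symS' : S'^T = S' by rewrite /S' !trmx_mul symH symS mulmxA.
have row0S' : delta_mx 0 0 *m S' = a *: (delta_mx 0 0 : 'rV_(1 + n)).
  by rewrite /S' !mulmxA eH vS -scalemxAl -eH -mulmxA HH mulmx1.
have S'E : S' = H *m S *m H by [].
clearbody S'.
have ur0 : ursubmx S' = 0.
  apply/matrixP => i j; move/matrixP/(_ 0 (rshift 1 j)): row0S'.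
  rewrite -rowE !mxE ord1 /= mulr0 => <-; congr (S' _ _); exact/val_inj.
have dl0 : dlsubmx S' = 0 by rewrite -[dlsubmx _]trmxK trmx_dlsub symS' ur0 trmx0.
have [|Q1 [orthQ1 diagQ1]] := IH (drsubmx S').
  by rewrite trmx_drsub symS'.
pose B : 'M[R]_(1 + n) := block_mx 1%:M 0 0 Q1.
have BT : B^T = block_mx 1%:M 0 0 Q1^T by rewrite tr_block_mx trmx1 !trmx0.
have BB : B^T *m B = 1%:M.
  rewrite BT /B mulmx_block.
  by rewrite !mul0mx !mulmx0 !addr0 add0r mulmx1 orthQ1 -scalar_mx_block.
have diagB : is_diag_mx (B^T *m S' *m B).
  rewrite -[S']submxK ur0 dl0 BT /B !mulmx_block.
  rewrite !mul0mx !mulmx0 !addr0 !add0r mulmx1 mul1mx !mul0mx.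
  rewrite is_diag_block_mx ?eqxx //= diagQ1 andbT.
  by apply/is_diag_mxP => i j; rewrite !ord1.
exists (H *m B); rewrite trmx_mul symH; split.
  by rewrite mulmxA -(mulmxA B^T) HH mulmx1 BB.
by move: diagB; rewrite S'E !mulmxA.
Qed.

(** * Moments of the standard normal law *)

Lemma normal_pdf_exp (R : realType) (s x : R) : s != 0 ->
  normal_pdf 0 s x = normal_peak s * expR (- x ^+ 2 / (s ^+ 2 *+ 2)).
Proof. by move=> s0; rewrite normal_pdfE// /normal_fun subr0. Qed.

Lemma expr_norm_le_expR (R : realType) (x : R) k : `|x| ^+ k <= k`!%:R * expR `|x|.
Proof.
case: k => [|k]; first by rewrite expr0 mul1r -[leLHS]expR0 ler_expR.
have := @expR_ge1Dxn _ `|x| k (normr_ge0 x).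
rewrite -lerBrDl ler_pdivrMr ?ltr0n ?fact_gt0// mulrC => /le_trans; apply.
by rewrite ler_wpM2l ?ler0n// gerBl ler01.
Qed.

(** A Gaussian of twice the standard deviation absorbs any power. This one bound yields both
    integrability of the moments and decay of the boundary terms. *)
Lemma expr_normal_pdf_le (R : realType) k :
  exists C : R, forall x, `|x ^+ k| * normal_pdf 0 1 x <= C * normal_pdf 0 2 x.
Proof.
(* [expR 1] comes from [|x| - x^2/2 <= 1 - x^2/8], proved below by completing the square; the peaks
   adjust the normalizations. *)
exists (k`!%:R * expR 1 * normal_peak 1 / normal_peak 2) => x.
have n2 : (2 : R) != 0 by [].
rewrite !normal_pdf_exp// normrX.
have p2 := normal_peak_gt0 n2.
rewrite [leRHS]mulrA divfK ?gt_eqF// mulrCA [leRHS]mulrAC [leRHS]mulrC.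
rewrite ler_wpM2l ?normal_peak_ge0//.
apply: le_trans (_ : k`!%:R * expR `|x| * expR (- x ^+ 2 / (1 ^+ 2 *+ 2)) <= _).
  by rewrite ler_wpM2r ?expR_ge0// expr_norm_le_expR.
rewrite -!mulrA ler_wpM2l ?ler0n// -!expRD ler_expR.
rewrite -(real_normK (num_real x)) -subr_ge0.
rewrite (_ : _ - _ = 3 / 8 * (`|x| - 4 / 3) ^+ 2 + 1 / 3); last by field.
have := sqr_ge0 (`|x| - 4 / 3); lra.
Qed.

Lemma measurable_exprn (R : realType) k :
  measurable_fun setT (fun x : R => x ^+ k).
Proof. by apply: measurable_funX. Qed.

Lemma integrable_expr_normal_pdf (R : realType) k :
  (@lebesgue_measure R).-integrable setT
    (EFin \o (fun x => x ^+ k * normal_pdf 0 1 x)).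
Proof.
have [C hC] := @expr_normal_pdf_le R k.
have intg := integrableZl measurableT C (@integrable_normal_pdf R 0 2).
apply: le_integrable intg => //.
- apply/measurable_EFinP; apply: measurable_funM; last exact: measurable_normal_pdf.
  exact: measurable_exprn.
- move=> x _ /=; rewrite lee_fin normrM (ger0_norm (normal_pdf_ge0 _ _ _)).
  by apply: le_trans (hC x) _; exact: ler_norm.
Qed.

(** The fundamental theorem of calculus on growing symmetric intervals, with dominated convergence
    (majorant [|f|]) to pass to the whole line. *)
Lemma integral_derive_eq0 (R : realType) (F f : R -> R) :
  (forall x : R, is_derive x 1 F (f x)) -> continuous f ->
  (@lebesgue_measure R).-integrable setT (EFin \o f) ->
  F n.+1%:R @[n --> \oo] --> (0 : R) -> F (- n.+1%:R) @[n --> \oo] --> (0 : R) ->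
  (\int[lebesgue_measure]_x (f x)%:E = 0)%E.
Proof.
move=> dF cf intf Fy FNy.
have cF : continuous F.
  move=> x; apply: differentiable_continuous.
  exact/derivable1_diffP/(@ex_derive _ _ _ _ _ _ _ (dF x)).
(* The successor keeps the interval nondegenerate at [n = 0]. *)
pose I (n : nat) : set R := `[- n.+1%:R, n.+1%:R]%classic.
have intI n : (\int[lebesgue_measure]_x ((f \_ (I n)) x)%:E =
               (F n.+1%:R - F (- n.+1%:R))%:E)%E.
  rewrite EFinB -(@continuous_FTC2 _ f F).
  - rewrite [RHS]integral_mkcond/=; apply: eq_integral => x _.
    by rewrite restrict_EFin.
  - by rewrite gtrN// ltr0n.
  - exact: continuous_subspaceT.
  - split=> [x _||]; first exact: ex_derive.
    + exact/cvg_at_right_filter/cF.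
    + exact/cvg_at_left_filter/cF.
  - by move=> x _; rewrite derive1E derive_val.
have : (\int[lebesgue_measure]_x ((f \_ (I n)) x)%:E)%E @[n --> \oo] -->
       (\int[lebesgue_measure]_x (f x)%:E)%E.
  apply: (@dominated_cvg _ (measurableTypeR R) R lebesgue_measure setT measurableT
    (fun n x => ((f \_ (I n)) x)%:E) (EFin \o f) (abse \o (EFin \o f))).
  - move=> n; apply/measurable_EFinP.
    apply: (measurable_restrictT f (measurable_itv _)).1.
    by apply: measurable_funTS; exact: continuous_measurable_fun.
  - move=> x _; apply: cvg_near_cst; near=> n.
    rewrite /= patchE mem_set//= /I /= in_itv /= -ler_norml.
    apply: (@le_trans _ _ n%:R); last by rewrite ler_nat.
    by near: n; exact: nbhs_infty_ger.
  - by [].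
  - exact: integrable_abse.
  - move=> n x _ /=; rewrite patchE; case: ifP => // _.
    by rewrite normr0 lee_fin.
under eq_cvg do rewrite intI.
move=> /cvg_unique; apply => //.
apply: cvg_EFin; first exact: nearW.
rewrite /comp /= -[0]subr0; exact: cvgB.
Unshelve. all: by end_near. Qed.

(** * Integration against the normal law through its density *)

Lemma ae_eq_density_normal_prob (R : realType) (m s : R) :
  ae_eq lebesgue_measure setT
    (Radon_Nikodym_SigmaFinite.f (normal_prob m s) lebesgue_measure)
    (EFin \o normal_pdf m s).
Proof.
have dom := @normal_prob_dominates R m s.
apply: integral_ae_eq => //.
- exact: Radon_Nikodym_SigmaFinite.f_integrable.
- by apply/measurable_EFinP; exact: measurable_normal_pdf.
- by move=> E _ mE; rewrite -Radon_Nikodym_SigmaFinite.f_integral.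
Qed.

(** The nonnegative case comes first: applied to absolute values of powers, it gives the
    integrability that the signed version presupposes. *)
Lemma ge0_integral_normal_prob (R : realType) (m s : R) (f : R -> \bar R) :
  (forall x, 0 <= f x)%E -> measurable_fun setT f ->
  (\int[normal_prob m s]_x f x =
   \int[lebesgue_measure]_x (f x * (normal_pdf m s x)%:E))%E.
Proof.
move=> f0 mf; have dom := @normal_prob_dominates R m s.
rewrite -(Radon_Nikodym_SigmaFinite.change_of_variables dom)//.
apply: ae_eq_integral => //.
- apply: emeasurable_funM => //.
  exact: measurable_int (Radon_Nikodym_SigmaFinite.f_integrable dom).
- apply: emeasurable_funM => //.
  by apply/measurable_EFinP; exact: measurable_normal_pdf.
- by apply: ae_eqe_mul2l; exact: ae_eq_density_normal_prob.
Qed.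

Lemma integral_normal_prob (R : realType) (m s : R) (f : R -> \bar R) :
  (normal_prob m s).-integrable setT f ->
  (\int[normal_prob m s]_x f x =
   \int[lebesgue_measure]_x (f x * (normal_pdf m s x)%:E))%E.
Proof.
move=> intf; have dom := @normal_prob_dominates R m s.
have mf := measurable_int _ intf.
rewrite -(Radon_Nikodym_change_of_variables dom)//.
apply: ae_eq_integral => //.
- exact: emeasurable_funM.
- apply: emeasurable_funM => //.
  by apply/measurable_EFinP; exact: measurable_normal_pdf.
- apply: ae_eqe_mul2l; apply: ae_eq_trans; last exact: ae_eq_density_normal_prob.
  by apply/ae_eq_sym; apply: ae_eq_Radon_Nikodym_SigmaFinite.
Qed.

Lemma integrable_exprn_normal_prob (R : realType) k :
  (normal_prob (0 : R) 1).-integrable setT (EFin \o (fun x => x ^+ k)).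
Proof.
have mk : measurable_fun setT (EFin \o (fun x : R => x ^+ k)).
  by apply/measurable_EFinP; exact: measurable_exprn.
apply/integrableP; split => //.
rewrite ge0_integral_normal_prob//; last exact: measurableT_comp.
have /integrableP[_] := @integrable_expr_normal_pdf R k.
congr (_ < _)%E; apply: eq_integral => x _ /=.
by rewrite normrM EFinM (ger0_norm (normal_pdf_ge0 _ _ _)).
Qed.

Definition normal_moment (R : realType) k : R :=
  Rintegral (normal_prob (0 : R) 1) setT (fun x => x ^+ k).

Lemma normal_momentE (R : realType) k : normal_moment R k =
  Rintegral lebesgue_measure setT (fun x : R => x ^+ k * normal_pdf 0 1 x).
Proof.
rewrite /normal_moment /Rintegral integral_normal_prob//.
exact: integrable_exprn_normal_prob.
Qed.

Lemma normal_moment0 (R : realType) : normal_moment R 0 = 1.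
Proof.
rewrite normal_momentE /Rintegral.
under eq_integral do rewrite expr0 mul1r.
by rewrite integral_normal_pdf.
Qed.

Lemma is_derive_normal_pdf (R : realType) (x : R) :
  is_derive x 1 (normal_pdf 0 1) (- x * normal_pdf 0 1 x).
Proof.
have E : normal_pdf 0 1 =
    (fun x : R => normal_peak 1 *: expR (- 2^-1 *: x ^+ 2)).
  apply/funext => y; rewrite normal_pdf_exp ?oner_eq0//.
  by congr (_ * expR _); rewrite /GRing.scale /= expr1n !mulNr mulrC.
rewrite E; apply: is_derive_eq.
by rewrite /GRing.scale /= !mulr1; field.
Qed.

Lemma cvg_expr_normal_pdf (R : realType) k (u : nat -> R) :
  (forall n, `|u n| = n.+1%:R) ->
  u n ^+ k * normal_pdf 0 1 (u n) @[n --> \oo] --> (0 : R).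
Proof.
(* Bounding one power more than required leaves a factor [1 / (n + 1)], which tends to 0. *)
move=> un; have [C hC] := @expr_normal_pdf_le R k.+1.
pose D := `|C| * normal_peak 2.
apply/norm_cvg0P.
apply: (@squeeze_cvgr _ _ _ _ (cst 0) (fun n => D * n.+1%:R^-1)).
- near=> n; rewrite normr_ge0 /= normrM (ger0_norm (normal_pdf_ge0 _ _ _)).
  rewrite ler_pdivlMr ?ltr0n// -un mulrAC -normrM -exprSr.
  apply: le_trans (hC _) _; apply: le_trans (ler_norm _) _.
  rewrite normrM (ger0_norm (normal_pdf_ge0 _ _ _)) ler_wpM2l//.
  by apply: normal_pdf_ub.
- exact: cvg_cst.
- rewrite -(mulr0 D); apply: cvgM; first exact: cvg_cst.
  exact: cvg_harmonic.
Unshelve. all: by end_near. Qed.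

(* Integrates the derivative of - x^k phi(x); for k = 0 the junk index k.-1 is
   killed by the factor k. *)
Lemma normal_momentS (R : realType) k :
  normal_moment R k.+1 = k%:R * normal_moment R k.-1.
Proof.
pose phi : R -> R := normal_pdf 0 1.
pose F (x : R) := - (x ^+ k * phi x).
pose f (x : R) := x ^+ k.+1 * phi x - k%:R * (x ^+ k.-1 * phi x).
have i1 := @integrable_expr_normal_pdf R k.+1.
have i2 := @integrable_expr_normal_pdf R k.-1.
have i3 : (@lebesgue_measure R).-integrable setT
    (EFin \o (fun x => k%:R * (x ^+ k.-1 * phi x))).
  exact: (integrableZl measurableT k%:R i2).
have f0 : (\int[lebesgue_measure]_x (f x)%:E = 0)%E.
  apply: (@integral_derive_eq0 _ F).
  - move=> x; rewrite /f.
    have dphi : is_derive x 1 phi (- x * phi x) by exact: is_derive_normal_pdf.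
    have -> : F = - (id ^+ k * phi) by apply/funext => y; rewrite /F !fctE.
    apply: is_derive_eq.
    rewrite exprfctE /GRing.scale /= exprS.
    by move: (x ^+ k) (x ^+ k.-1) (phi x) (k%:R : R) => *; ring.
  - have cphi : continuous phi by exact: continuous_normal_pdf.
    move=> x; apply: cvgB; [|apply: cvgM; first exact: cvg_cst];
      by apply: cvgM; [exact: exprn_continuous|exact: cphi].
  - exact: (integrableB measurableT i1 i3).
  - rewrite -[0]oppr0; apply: cvgN; apply: cvg_expr_normal_pdf => n.
    by rewrite ger0_norm.
  - rewrite -[0]oppr0; apply: cvgN; apply: cvg_expr_normal_pdf => n.
    by rewrite normrN ger0_norm.
apply/eqP; rewrite -subr_eq0 !normal_momentE -RintegralZl// -RintegralB//.
by rewrite /Rintegral f0.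
Qed.

(** * Wick's formula and the variance loss *)

Lemma Rintegral_sum d (T : measurableType d) (R : realType)
    (mu : {measure set T -> \bar R}) (D : set T) (I : Type) (s : seq I)
    (f : I -> T -> R) : measurable D ->
  (forall i, mu.-integrable D (EFin \o f i)) ->
  Rintegral mu D (fun x => \sum_(i <- s) f i x) =
  \sum_(i <- s) Rintegral mu D (f i).
Proof.
move=> mD intf; rewrite /Rintegral.
under eq_integral do rewrite -sumEFin.
rewrite integral_sum// (eq_bigr (fun i => (Rintegral mu D (f i))%:E)) ?sumEFin//.
by move=> i _; rewrite fineK//; apply: integrable_fin_num; last exact: intf.
Qed.

(** By independence, the expectation of the monomial with exponents [e]. *)
Definition gauss_moment (R : realType) n (e : nat -> nat) : R :=
  \prod_(k < n) normal_moment R (e k).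

Lemma gaussE_nat_monomials (R : realType) (I : finType) n (c : I -> R)
    (e : I -> nat -> nat) :
  gaussE_nat n (fun x => \sum_i c i * \prod_(k < n) x k ^+ e i k) =
  \sum_i c i * gauss_moment R n (e i).
Proof.
rewrite /gauss_moment; elim: n c e => [|n IH] c e /=.
  by apply: eq_bigr => i _; rewrite !big_ord0.
transitivity (Rintegral (normal_prob (0 : R) 1) setT (fun t => \sum_i
    (c i * \prod_(k < n) normal_moment R (e i k.+1)) * t ^+ e i 0)).
  apply: eq_Rintegral => t _.
  under [RHS]eq_bigr => i _ do rewrite mulrAC.
  (* For a fixed outermost variable [t], its power joins the coefficients; hence the induction is
     general in [c] and [e]. *)
  rewrite -(IH (fun i => c i * t ^+ e i 0) (fun i k => e i k.+1)).
  congr gaussE_nat; apply/funext => x; apply: eq_bigr => i _.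
  by rewrite big_ord_recl /= mulrA.
have intX i : (normal_prob (0 : R) 1).-integrable setT
    (EFin \o (fun t => (c i * \prod_(k < n) normal_moment R (e i k.+1)) * t ^+ e i 0)).
  exact: (integrableZl measurableT _ (integrable_exprn_normal_prob R (e i 0))).
rewrite Rintegral_sum//; apply: eq_bigr => i _.
rewrite RintegralZl//; last exact: integrable_exprn_normal_prob.
by rewrite big_ord_recl mulrAC mulrA.
Qed.

(* Gaussian integration by parts in the i-th variable; when e i = 0 the truncated
   subtraction is harmless because of the factor e i. *)
Lemma gauss_moment_stein (R : realType) n (e : nat -> nat) (i : 'I_n) :
  gauss_moment R n (fun k => (k == i) + e k)%N =
  (e i)%:R * gauss_moment R n (fun k => e k - (k == i))%N.
Proof.
rewrite /gauss_moment (bigD1 i)//= [in RHS](bigD1 i)//= eqxx add1n subn1.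
rewrite normal_momentS mulrA; congr (_ * _); apply: eq_bigr => k ki.
by rewrite (negbTE (_ : k != i :> nat))// add0n subn0.
Qed.

Lemma gauss_moment2 (R : realType) n (i j : 'I_n) :
  gauss_moment R n (fun k => (k == i) + (k == j))%N = (i == j)%:R.
Proof.
rewrite gauss_moment_stein; have [->|ij] := eqVneq i j; last first.
  by rewrite (negbTE (_ : i != j :> nat))// mul0r.
rewrite eqxx mul1r /gauss_moment big1// => k _.
by rewrite subnn normal_moment0.
Qed.

(** Integration by parts in [x_i] differentiates [x_j x_k x_l]; each of the three product-rule terms
    is a second moment and gives one Wick pairing. *)
Lemma gauss_moment4 (R : realType) n (i j k l : 'I_n) :
  gauss_moment R n (fun m => (m == i) + ((m == j) + ((m == k) + (m == l))))%N =
  (i == j)%:R * (k == l)%:R + (i == k)%:R * (j == l)%:R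
  + (i == l)%:R * (j == k)%:R.
Proof.
rewrite gauss_moment_stein !natrD !mulrDl addrA.
rewrite -(gauss_moment2 R k l) -(gauss_moment2 R j l) -(gauss_moment2 R j k).
congr (_ + _ + _).
- have [->|ij] := eqVneq i j; last first.
    by rewrite (negbTE (_ : i != j :> nat))// !mul0r.
  by rewrite eqxx; congr (_ * _); apply: eq_bigr => m _; congr normal_moment; lia.
- have [->|ij] := eqVneq i k; last first.
    by rewrite (negbTE (_ : i != k :> nat))// !mul0r.
  by rewrite eqxx; congr (_ * _); apply: eq_bigr => m _; congr normal_moment; lia.
- have [->|ij] := eqVneq i l; last first.
    by rewrite (negbTE (_ : i != l :> nat))// !mul0r.
  by rewrite eqxx; congr (_ * _); apply: eq_bigr => m _; congr normal_moment; lia.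
Qed.

Lemma prod_exprn_delta (R : comNzRingType) n (x : nat -> R) (i : 'I_n)
    (e : nat -> nat) :
  \prod_(k < n) x k ^+ ((k == i :> nat) + e k) = x i * \prod_(k < n) x k ^+ e k.
Proof.
rewrite (bigD1 i)//= [in RHS](bigD1 i)//= eqxx add1n exprS -!mulrA.
congr (_ * (_ * _)); apply: eq_bigr => k ki.
by rewrite (negbTE (_ : k != i :> nat)).
Qed.

Lemma prod_exprn_delta1 (R : comNzRingType) n (x : nat -> R) (i : 'I_n) :
  \prod_(k < n) x k ^+ (k == i :> nat) = x i.
Proof.
rewrite (bigD1 i)//= eqxx big1 ?mulr1// => k ki.
by rewrite (negbTE (_ : k != i :> nat)).
Qed.

Definition qform {R : realType} {d} (D : 'M[R]_d) (x : 'cV[R]_d) : R :=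
  (x^T *m D *m x) 0 0.

Lemma qformE (R : realType) d (D : 'M[R]_d) (x : 'cV[R]_d) :
  qform D x = \sum_(p : 'I_d * 'I_d) D p.1 p.2 * (x p.1 0 * x p.2 0).
Proof.
rewrite /qform mxE -(pair_bigA _ (fun i j => D i j * (x i 0 * x j 0))) /=.
rewrite exchange_big; apply: eq_bigr => j _ /=.
rewrite mxE mulr_suml; apply: eq_bigr => i _; rewrite mxE; ring.
Qed.

Lemma gaussE_qform (R : realType) d (D : 'M[R]_d) :
  gaussE (qform D) = \tr D.
Proof.
transitivity (gaussE_nat d (fun x : nat -> R => \sum_(p : 'I_d * 'I_d) D p.1 p.2 *
    \prod_(k < d) x k ^+ ((k == p.1 :> nat) + (k == p.2 :> nat)))).
  congr gaussE_nat; apply/funext => x; rewrite qformE; apply: eq_bigr => p _.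
  rewrite (prod_exprn_delta x p.1 (fun k => k == p.2)).
  by rewrite prod_exprn_delta1 !mxE.
rewrite (@gaussE_nat_monomials _ _ _ _
  (fun (p : 'I_d * 'I_d) k => (k == p.1 :> nat) + (k == p.2 :> nat))%N).
under eq_bigr do rewrite gauss_moment2.
rewrite -(pair_bigA _ (fun i j => D i j * (i == j)%:R)) /=.
apply: eq_bigr => i _; rewrite (bigD1 i)//= eqxx mulr1 big1 ?addr0// => j ji.
by rewrite eq_sym (negbTE ji) mulr0.
Qed.

(** Summed against [D i j * D k l], the pairing ij|kl gives the squared trace. The pairings ik|jl
    and il|jk give the sums of [D i j ^+ 2] and of [D i j * D j i], which symmetry makes equal to
    [\tr (D *m D)]. *)
Lemma gaussE_qform_sqr (R : realType) d (D : 'M[R]_d) : D^T = D ->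
  gaussE (fun x => qform D x ^+ 2) = \tr D ^+ 2 + 2 * \tr (D *m D).
Proof.
move=> symD; pose T := (('I_d * 'I_d) * ('I_d * 'I_d))%type.
pose c (p : T) := D p.1.1 p.1.2 * D p.2.1 p.2.2.
pose e (p : T) k := ((k == p.1.1 :> nat) + ((k == p.1.2 :> nat) +
  ((k == p.2.1 :> nat) + (k == p.2.2 :> nat))))%N.
transitivity (gaussE_nat d (fun x : nat -> R =>
    \sum_(p : T) c p * \prod_(k < d) x k ^+ e p k)).
  congr gaussE_nat; apply/funext => x.
  rewrite expr2 qformE big_distrlr /=.
  rewrite (pair_bigA _ (fun p q : 'I_d * 'I_d => D p.1 p.2 *
    ((\col_i x i) p.1 0 * (\col_i x i) p.2 0) * (D q.1 q.2 *
    ((\col_i x i) q.1 0 * (\col_i x i) q.2 0)))) /=.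
  apply: eq_bigr => -[[i j] [k l]] _; rewrite /c /e /=.
  rewrite (prod_exprn_delta x i (fun m => (m == j) + ((m == k) + (m == l)))%N).
  rewrite (prod_exprn_delta x j (fun m => (m == k) + (m == l))%N).
  rewrite (prod_exprn_delta x k (fun m => m == l)).
  rewrite prod_exprn_delta1 !mxE; ring.
rewrite gaussE_nat_monomials.
under eq_bigr do rewrite /e gauss_moment4 /c !mulrDr.
rewrite !big_split /= expr2 mulr2n mulrDl mul1r addrA.
have delta (f : 'I_d -> R) i : \sum_j (i == j)%:R * f j = f i.
  rewrite (bigD1 i)//= eqxx mul1r big1 ?addr0// => j ji.
  by rewrite eq_sym (negbTE ji) mul0r.
have pairs (F : 'I_d -> 'I_d -> 'I_d -> 'I_d -> R) :
    \sum_(p : T) F p.1.1 p.1.2 p.2.1 p.2.2 =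
    \sum_i \sum_j \sum_k \sum_l F i j k l.
  rewrite -(pair_bigA _ (fun p q => F p.1 p.2 q.1 q.2)) /=.
  rewrite -(pair_bigA _ (fun i j => \sum_q F i j q.1 q.2)) /=.
  apply: eq_bigr => i _; apply: eq_bigr => j _.
  by rewrite -(pair_bigA _ (fun k l => F i j k l)).
have trDD : \sum_i \sum_j D i j * D i j = \tr (D *m D).
  apply: eq_bigr => i _; rewrite mxE; apply: eq_bigr => j _.
  by rewrite -[in D j i]symD mxE.
congr (_ + _ + _).
- rewrite (pairs (fun i j k l => D i j * D k l * ((i == j)%:R * (k == l)%:R))).
  rewrite /mxtrace big_distrl; apply: eq_bigr => i _ /=.
  rewrite big_distrr exchange_big /=; apply: eq_bigr => k _.
  rewrite -(delta (fun j => D i j * D k k)); apply: eq_bigr => j _.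
  rewrite -(delta (fun l => D i j * D k l)) mulr_sumr; apply: eq_bigr => l _; ring.
- rewrite (pairs (fun i j k l => D i j * D k l * ((i == k)%:R * (j == l)%:R))).
  rewrite -trDD; apply: eq_bigr => i _; apply: eq_bigr => j _ /=.
  rewrite -(delta (fun k => D i j * D k j)); apply: eq_bigr => k _.
  rewrite -(delta (fun l => D i j * D k l)) mulr_sumr; apply: eq_bigr => l _; ring.
- rewrite (pairs (fun i j k l => D i j * D k l * ((i == l)%:R * (j == k)%:R))).
  rewrite -trDD; apply: eq_bigr => i _; apply: eq_bigr => j _ /=.
  rewrite -[in X in _ = _ * X]symD mxE.
  rewrite -(delta (fun k => D i j * D k i)); apply: eq_bigr => k _.
  rewrite -(delta (fun l => D i j * D k l)) mulr_sumr; apply: eq_bigr => l _; ring.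
Qed.

Lemma label_sub_fnet (R : realType) d (Ws W : 'M[R]_d) (x : 'cV[R]_d) :
  label Ws x - fnet W x = qform (Ws^T *m Ws - W^T *m W) x.
Proof.
have -> : fnet W x = ((W *m x)^T *m (W *m x)) 0 0.
  rewrite mxE; apply: eq_bigr => i _; rewrite -row_mul !mxE expr2.
  by rewrite !big_distrlr.
by rewrite /label /qform mulmxBr mulmxBl trmx_mul !mulmxA !mxE.
Qed.

(** The squared mean in the loss cancels exactly the squared trace in the second moment. *)
Lemma lvarE (R : realType) d (Ws W : 'M[R]_d) :
  let D := Ws^T *m Ws - W^T *m W in lvar Ws W = 8^-1 * \tr (D *m D).
Proof.
move=> D; rewrite /lvar.
have -> : (fun x => label Ws x - fnet W x) = qform D.
  by apply/funext => x; rewrite label_sub_fnet.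
under [X in gaussE X]eq_fun do rewrite label_sub_fnet.
rewrite gaussE_qform gaussE_qform_sqr; last first.
  by rewrite linearB /= !trmx_mul !trmxK.
by rewrite -/D; move: (\tr D) (\tr (D *m D)) => a b; field.
Qed.

(** * The gradient of the variance loss *)

Lemma mxtrace_mul_eq0 (R : realType) m n (A : 'M[R]_(m, n)) :
  (forall V : 'M[R]_(n, m), \tr (A *m V) = 0) -> A = 0.
Proof.
(* Testing against [A^T] turns the trace into the sum of the squared entries of [A]. *)
move=> /(_ A^T) A0; apply/matrixP => i j; rewrite mxE; move: A0.
rewrite /mxtrace => /eqP; rewrite psumr_eq0; last first.
  by move=> k _; rewrite mxE sumr_ge0// => l _; rewrite mxE -expr2 sqr_ge0.
move=> /allP/(_ i); rewrite mem_index_enum => /(_ isT)/implyP/(_ isT).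
rewrite mxE psumr_eq0; last by move=> l _; rewrite mxE -expr2 sqr_ge0.
move=> /allP/(_ j); rewrite mem_index_enum => /(_ isT)/implyP/(_ isT).
by rewrite mxE mulf_eq0 orbb => /eqP.
Qed.

(** Along the line [W + h V] the residual [D] becomes this quadratic pencil; the expansion isolates
    the part linear in [h]. *)
Lemma mxtrace_quadratic_pencil (R : comNzRingType) d (D S P : 'M[R]_d) (h : R) :
  let X := D - h *: S - h ^+ 2 *: P in
  \tr (X *m X) = \tr (D *m D) - h * (\tr (D *m S) *+ 2) +
    h ^+ 2 * (\tr (S *m S) - \tr (D *m P) *+ 2 +
      h * (\tr (S *m P) *+ 2) + h ^+ 2 * \tr (P *m P)).
Proof.
rewrite /= !mulmxBl !mulmxBr -!scalemxAl -!scalemxAr.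
rewrite !(raddfB (@mxtrace R d)) /= !mxtraceZ.
rewrite (mxtrace_mulC S D) (mxtrace_mulC P D) (mxtrace_mulC P S).
ring.
Qed.

Lemma derive_lvar (R : realType) d (Ws W V : 'M[R]_d) :
  'D_V (lvar Ws) W = - 2^-1 * \tr ((Ws^T *m Ws - W^T *m W) *m W^T *m V).
Proof.
set D := Ws^T *m Ws - W^T *m W.
pose S := V^T *m W + W^T *m V; pose P := V^T *m V.
have symD : D^T = D by rewrite linearB /= !trmx_mul !trmxK.
have tDS : \tr (D *m S) = 2 * \tr (D *m W^T *m V).
  rewrite mulmxDr linearD /= mulr2n mulrDl mul1r mulmxA.
  congr (_ + _); last by rewrite mulmxA.
  by rewrite -mxtrace_tr !trmx_mul trmxK symD mulmxA mxtrace_mulC mulmxA.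
pose r h := 8^-1 * (\tr (S *m S) - \tr (D *m P) *+ 2 +
  h * (\tr (S *m P) *+ 2) + h ^+ 2 * \tr (P *m P)).
have expand h : lvar Ws (h *: V + W) - lvar Ws W =
    h * (- 4^-1 * \tr (D *m S) + h * r h).
  rewrite !lvarE -/D.
  have -> : Ws^T *m Ws - (h *: V + W)^T *m (h *: V + W) =
      D - h *: S - h ^+ 2 *: P.
    rewrite [(_ + _)^T]linearD /= [(h *: V)^T]linearZ /= mulmxDl !mulmxDr.
    rewrite -!scalemxAl -!scalemxAr /S /P /D.
    move: (V^T *m V) (V^T *m W) (W^T *m V) (W^T *m W) (Ws^T *m Ws) => X1 X2 X3 X4 X5.
    by apply/matrixP => i j; rewrite !mxE; ring.
  rewrite mxtrace_quadratic_pencil /r.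
  move: (\tr (D *m D)) (\tr (D *m S)) (\tr (S *m S)) (\tr (D *m P)).
  by move: (\tr (S *m P)) (\tr (P *m P)) => *; field.
apply: cvg_lim => //.
have -> : - 2^-1 * \tr (D *m W^T *m V) = - 4^-1 * \tr (D *m S) + 0 * r 0.
  by rewrite tDS; move: (\tr _) (r 0) => *; field.
(* Away from [h = 0] the difference quotient is this polynomial in [h], so its limit is the value at
   0. *)
apply: (@cvg_trans _ ((fun h => - 4^-1 * \tr (D *m S) + h * r h) @ 0^')).
  apply: near_eq_cvg; near=> h.
  have h0 : h != 0 by near: h; exact: nbhs_dnbhs_neq.
  by rewrite /= expand /GRing.scale /= mulKf.
apply: cvg_within_filter.
apply: cvgD; first exact: cvg_cst.
apply: cvgM; first exact: cvg_id.
apply: cvgM; first exact: cvg_cst.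
apply: cvgD; last by apply: cvgM; [exact: exprn_continuous|exact: cvg_cst].
apply: cvgD; first exact: cvg_cst.
by apply: cvgM; [exact: cvg_id|exact: cvg_cst].
Unshelve. all: by end_near. Qed.

(** The differential of the loss agrees with the computed directional derivative in every direction,
    and nondegeneracy of the trace pairing then determines [G]. *)
Lemma is_grad_lvarE (R : realType) d (Ws W G : 'M[R]_d) :
  is_grad (lvar Ws) W G -> - G = 2^-1 *: (W *m (Ws^T *m Ws - W^T *m W)).
Proof.
move=> [df dG]; set D := Ws^T *m Ws - W^T *m W.
have symD : D^T = D by rewrite linearB /= !trmx_mul !trmxK.
suff : G^T + 2^-1 *: (D *m W^T) = 0.
  move/(congr1 trmx); rewrite linearD /= linearZ /= trmxK trmx_mul trmxK symD.
  by rewrite linear0 => /eqP; rewrite addr_eq0 => /eqP ->; rewrite opprK.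
apply: mxtrace_mul_eq0 => V.
rewrite mulmxDl linearD /= -dG -deriveE// derive_lvar -/D.
by rewrite -scalemxAl linearZ /= mulNr addNr.
Qed.

(** * Matrix-valued differential equations *)

Lemma is_derive_mxP (R : realType) m n (M : R -> 'M[R]_(m, n)) (dM : 'M[R]_(m, n))
    (t : R) :
  is_derive t 1 M dM <-> forall i j, is_derive t 1 (fun s => M s i j) (dM i j).
Proof.
split=> [dMt i j|dMt].
  have dm : derivable M t 1 by exact: ex_derive.
  have dmij := (derivable_mxP M t 1).1 dm i j.
  split; first exact: dmij.
  by rewrite -(@derive_val _ _ _ _ _ _ _ dMt) derive_mx// mxE.
have dm : derivable M t 1.
  by apply/derivable_mxP => i j; exact: (@ex_derive _ _ _ _ _ _ _ (dMt i j)).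
split; first exact: dm.
rewrite derive_mx//; apply/matrixP => i j; rewrite mxE.
exact: (@derive_val _ _ _ _ _ _ _ (dMt i j)).
Qed.

Lemma is_derive_fsum (R : realType) (I : Type) (s : seq I) (f : I -> R -> R)
    (df : I -> R) (t : R) :
  (forall i, is_derive t 1 (f i) (df i)) ->
  is_derive t 1 (fun x => \sum_(i <- s) f i x) (\sum_(i <- s) df i).
Proof.
move=> dfi; elim: s => [|i s IH].
  under eq_fun do rewrite big_nil.
  by rewrite big_nil; exact: is_derive_cst.
under eq_fun do rewrite big_cons.
by rewrite big_cons; exact: is_deriveD.
Qed.

Lemma cvg_fsum (R : realType) (T I : Type) (F : set_system T) (s : seq I)
    (f : I -> T -> R) (l : I -> R) : Filter F ->
  (forall i, f i x @[x --> F] --> l i) ->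
  (\sum_(i <- s) f i x) @[x --> F] --> \sum_(i <- s) l i.
Proof. by move=> FF fl; apply: cvg_big => //; exact: add_continuous. Qed.

Lemma is_derive_mulmx (R : realType) m n p (A : R -> 'M[R]_(m, n))
    (B : R -> 'M[R]_(n, p)) (dA : 'M[R]_(m, n)) (dB : 'M[R]_(n, p)) (t : R) :
  is_derive t 1 A dA -> is_derive t 1 B dB ->
  is_derive t 1 (fun s => A s *m B s) (dA *m B t + A t *m dB).
Proof.
move=> /is_derive_mxP hA /is_derive_mxP hB; apply/is_derive_mxP => i j.
under eq_fun do rewrite mxE.
rewrite !mxE -big_split; apply: is_derive_fsum => k.
apply: (is_derive_eq (is_deriveM (hA i k) (hB k j))).
by rewrite /GRing.scale /= addrC; congr (_ + _); exact: mulrC.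
Qed.

Lemma is_derive_trmx (R : realType) m n (A : R -> 'M[R]_(m, n))
    (dA : 'M[R]_(m, n)) (t : R) :
  is_derive t 1 A dA -> is_derive t 1 (fun s => (A s)^T) dA^T.
Proof.
move=> /is_derive_mxP hA; apply/is_derive_mxP => i j.
by under eq_fun do rewrite mxE; rewrite mxE.
Qed.

(** The product of [u] with [expR (- K * t)] is nonincreasing. At time 0 only a right limit is
    assumed, matching [grad_flow]. *)
Lemma gronwall_le0 (R : realType) (u u' : R -> R) (K T : R) : 0 <= T ->
  (forall t : R, 0 < t -> is_derive t (1 : R) u (u' t)) ->
  u x @[x --> (0 : R)^'+] --> u 0 ->
  (forall t : R, 0 < t < T -> u' t <= K * u t) ->
  u 0 <= 0 -> u T <= 0.
Proof.
rewrite le_eqVlt => /predU1P[<-//|T0] du cu u'K u0.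
pose v (t : R) := u t * expR (- K * t).
have dv (t : R) : 0 < t ->
    is_derive t (1 : R) v ((u' t - K * u t) * expR (- K * t)).
  move=> t0; have dut := du _ t0.
  have de : is_derive t (1 : R) (fun s => expR (- K * s)) (expR (- K * t) * - K).
    by apply: is_derive_eq; rewrite /GRing.scale /= mulr1.
  apply: (is_derive_eq (is_deriveM dut de)).
  rewrite /GRing.scale /=; ring.
have cv : {within `[0, T], continuous v}.
  have ce : continuous (fun s : R => expR (- K * s)).
    move=> s; apply: continuous_comp; last exact: continuous_expR.
    by apply: continuousM; [exact: cvg_cst|exact: cvg_id].
  apply/continuous_within_itvP => //; split.
  - move=> t; rewrite in_itv /= => /andP[t0 _].
    apply: differentiable_continuous; apply/derivable1_diffP.
    exact: (@ex_derive _ _ _ _ _ _ _ (dv _ t0)).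
  - by apply: cvgM => //; apply: cvg_at_right_filter; exact: ce.
  - apply: cvg_at_left_filter.
    apply: differentiable_continuous; apply/derivable1_diffP.
    exact: (@ex_derive _ _ _ _ _ _ _ (dv _ T0)).
have : v T <= v 0.
  apply: (ler0_derive1_nincr _ _ cv) => //; last exact: ltW.
  - move=> t; rewrite in_itv /= => /andP[t0 _].
    exact: (@ex_derive _ _ _ _ _ _ _ (dv _ t0)).
  - move=> t; rewrite in_itv /= => t0T; have /andP[t0 _] := t0T.
    rewrite derive1E (@derive_val _ _ _ _ _ _ _ (dv _ t0)).
    by rewrite mulr_le0_ge0 ?expR_ge0// subr_le0 u'K.
rewrite /v mulr0 expR0 mulr1 => /le_trans/(_ u0).
by rewrite pmulr_lle0// expR_gt0.
Qed.

Lemma within_continuous_bounded (R : realType) (f : R -> R) (a b : R) : a <= b ->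
  {within `[a, b], continuous f} -> exists B, forall t : R, a <= t <= b -> f t <= B.
Proof.
move=> ab cf; have [c _ hc] := EVT_max ab cf.
by exists (f c) => t tab; apply: hc; rewrite in_itv.
Qed.

(** Gronwall applied to the squared Frobenius norm of [C], the entries of [A] being bounded on the
    compact interval. *)
Lemma sylvester_ode_eq0 (R : realType) d (A C : R -> 'M[R]_d) (T : R) : 0 <= T ->
  (forall t : R, 0 < t -> is_derive t (1 : R) C (A t *m C t + C t *m A t)) ->
  (forall i j, C x i j @[x --> (0 : R)^'+] --> C 0 i j) ->
  (forall i j, {within `[0, T], continuous (fun t => A t i j)}) ->
  C 0 = 0 -> C T = 0.
Proof.
move=> T0 dC cC cA C0.
pose g t := \sum_(p : 'I_d * 'I_d) `|A t p.1 p.2|.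
have [B hB] : exists B, forall t : R, 0 <= t <= T -> g t <= B.
  apply: within_continuous_bounded => // t.
  apply: cvg_fsum => p.
  by apply: cvg_norm; exact: cA.
have AB (t : R) i j : 0 <= t <= T -> `|A t i j| <= B.
  move=> tT; apply: le_trans (hB t tT).
  by rewrite /g (bigD1 (i, j))//= lerDl sumr_ge0.
have B0 : 0 <= B by apply: le_trans (hB 0 _); rewrite ?lexx// sumr_ge0.
pose u t := \sum_(p : 'I_d * 'I_d) C t p.1 p.2 ^+ 2.
pose u' t := \sum_(p : 'I_d * 'I_d)
  2 * C t p.1 p.2 * (A t *m C t + C t *m A t) p.1 p.2.
have Cu t i j : C t i j ^+ 2 <= u t.
  by rewrite /u (bigD1 (i, j))//= lerDl sumr_ge0// => p _; exact: sqr_ge0.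
have CCu t i j k l : `|C t i j * C t k l| <= u t.
  rewrite normrM; have := Cu t i j; have := Cu t k l.
  rewrite -(real_normK (num_real (C t i j))) -(real_normK (num_real (C t k l))).
  move: (`|C t i j|) (`|C t k l|) => a b.
  have := sqr_ge0 (a - b); rewrite sqrrB; lra.
have uT : u T <= 0.
  (* For each entry and each [k], the two matrix products contribute one term apiece: an entry of
     [A], at most [B], times a product of two entries of [C], at most [u t]. *)
  apply: (@gronwall_le0 _ u u' (\sum_(p : 'I_d * 'I_d) (2 * (\sum_(k < d) (B + B))))) => //.
  - move=> t t0; apply: is_derive_fsum => p.
    have /is_derive_mxP/(_ p.1 p.2) dp := dC t t0.
    apply: (is_derive_eq (is_deriveX 2 dp)).
    by rewrite /GRing.scale /= expr1 [LHS]mulrC mulrC.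
  - apply: cvg_fsum => p; rewrite expr2; under eq_fun do rewrite expr2.
    by apply: cvgM; exact: cC.
  - move=> t /andP[/ltW t0 /ltW tT]; have tT' : 0 <= t <= T by rewrite t0.
    rewrite mulr_suml; apply: ler_sum => p _; rewrite -mulrA -[leRHS]mulrA.
    rewrite ler_wpM2l// !mxE -big_split mulr_sumr mulr_suml; apply: ler_sum => k _.
    rewrite /= mulrDr mulrDl; apply: lerD; apply: le_trans (ler_norm _) _.
    + by rewrite mulrCA normrM; apply: ler_pM => //; exact: AB.
    + by rewrite mulrA normrM mulrC; apply: ler_pM => //; exact: AB.
  - by rewrite /u big1// => p _; rewrite C0 mxE expr0n.
apply/matrixP => i j; rewrite mxE; apply/eqP; rewrite -sqrf_eq0 eq_le sqr_ge0 andbT.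
exact: le_trans uT.
Qed.

Lemma cvg_mulmx_entries (R : realType) (T : Type) (F : set_system T) m n p
    (A : T -> 'M[R]_(m, n)) (B : T -> 'M[R]_(n, p)) (LA : 'M[R]_(m, n))
    (LB : 'M[R]_(n, p)) : Filter F ->
  (forall i j, A x i j @[x --> F] --> LA i j) ->
  (forall i j, B x i j @[x --> F] --> LB i j) ->
  forall i j, (A x *m B x) i j @[x --> F] --> (LA *m LB) i j.
Proof.
move=> FF cA cB i j; under eq_fun do rewrite mxE; rewrite mxE.
by apply: cvg_fsum => k; exact: cvgM.
Qed.

(** The commutator with [E] is a derivation that kills [a]; applied to the Riccati right-hand side
    it gives an expression linear in the commutator of [E] and [X]. *)
Lemma commutator_riccati (R : comNzRingType) d (E a X : 'M[R]_d) :
  E *m a = a *m E ->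
  E *m (a *m X + X *m a - X *m X) - (a *m X + X *m a - X *m X) *m E =
  (a - X) *m (E *m X - X *m E) + (E *m X - X *m E) *m (a - X).
Proof.
move=> Ea; rewrite !(mulmxDl, mulmxDr, mulNmx, mulmxN) !mulmxA Ea.
rewrite -(mulmxA X a E) -Ea !mulmxA.
move: (E *m a *m X) (E *m X *m a) (E *m X *m X) (a *m X *m E) => x1 x2 x3 x4.
move: (X *m E *m a) (X *m X *m E) (X *m E *m X) => x5 x6 x7.
by apply/matrixP => i j; rewrite !mxE; ring.
Qed.

(** * Diagonality along the flow and the logistic equations *)

Theorem theorem5 (R : realType) (d : nat) (sigma0 : R) (Wstar : 'M[R]_d)
    (W : R -> 'M[R]_d) :
  (0 < d)%N -> 0 < sigma0 ->
  (W 0)^T *m W 0 = sigma0%:M ->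
  grad_flow (lvar Wstar) W ->
  exists Q : 'M[R]_d,
    Q^T *m Q = 1%:M /\
    is_diag_mx (Q^T *m (Wstar^T *m Wstar) *m Q) /\
    (forall t : R, 0 <= t -> is_diag_mx (Q^T *m ((W t)^T *m W t) *m Q)) /\
    (forall (i : 'I_d) (t : R), 0 < t ->
       is_derive t 1 (fun s : R => (Q^T *m ((W s)^T *m W s) *m Q) i i)
         ((Q^T *m ((W t)^T *m W t) *m Q) i i *
          ((Q^T *m (Wstar^T *m Wstar) *m Q) i i
           - (Q^T *m ((W t)^T *m W t) *m Q) i i))).
Proof.
move=> _ _ W0 [dW cW].
pose Ms := Wstar^T *m Wstar.
have [|Q [QQ diagS]] := @symmetric_diagonalizable _ _ Ms.
  by rewrite trmx_mul trmxK.
have QQ' := mulmx1C QQ.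
pose M t := (W t)^T *m W t.
pose S := Q^T *m Ms *m Q; pose N t := Q^T *m M t *m Q.
(* Halving [S] turns the conjugated flow [(S N + N S) / 2 - N^2] into [a N + N a - N^2]. *)
pose a := 2^-1 *: S.
have dN (t : R) : 0 < t -> is_derive t 1 N (a *m N t + N t *m a - N t *m N t).
  move=> t0; have [G [/is_grad_lvarE GE]] := dW t t0; rewrite {}GE => dWt.
  have h := is_derive_mulmx (is_derive_mulmx
    (is_derive_cst Q^T t 1)
    (is_derive_mulmx (is_derive_trmx dWt) dWt))
    (is_derive_cst Q t 1).
  apply: (is_derive_eq h).
  rewrite mul0mx add0r mulmx0 addr0 linearZ /= trmx_mul.
  have -> : (Wstar^T *m Wstar - (W t)^T *m W t)^T = Ms - M t.
    by rewrite linearB /= !trmx_mul !trmxK.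
  have SN : a *m N t = 2^-1 *: (Q^T *m (Ms *m M t) *m Q).
    rewrite /a -scalemxAl; congr (_ *: _).
    by rewrite /S /N !mulmxA -(mulmxA _ Q Q^T) QQ' mulmx1.
  have NS : N t *m a = 2^-1 *: (Q^T *m (M t *m Ms) *m Q).
    rewrite /a -scalemxAr; congr (_ *: _).
    by rewrite /S /N !mulmxA -(mulmxA _ Q Q^T) QQ' mulmx1.
  have NN : N t *m N t = Q^T *m (M t *m M t) *m Q.
    by rewrite /N !mulmxA -(mulmxA _ Q Q^T) QQ' mulmx1.
  rewrite SN NS NN -!scalemxAl -!scalemxAr -(mulmxA _ (W t)^T (W t)) -/(M t).
  rewrite (mulmxA (W t)^T (W t)) -/(M t) mulmxBl mulmxBr.
  rewrite mulmxDr mulmxDl -!scalemxAr -!scalemxAl !mulmxBr !mulmxBl.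
  by apply/matrixP => i j; rewrite !mxE; field.
have cW0 i j : W x i j @[x --> (0 : R)^'+] --> W 0 i j.
  exact: (cvg_comp W (fun X : 'M[R]_d => X i j) cW (@coord_continuous _ _ _ i j _)).
have cN i j : N x i j @[x --> (0 : R)^'+] --> N 0 i j.
  apply: cvg_mulmx_entries; last by move=> *; exact: cvg_cst.
  apply: cvg_mulmx_entries; first by move=> *; exact: cvg_cst.
  apply: cvg_mulmx_entries => // k l.
  under eq_fun do rewrite mxE; rewrite mxE; exact: cW0.
(* A scalar matrix is unchanged by orthogonal conjugation, so the initial value commutes with every
   [E]. *)
have N0 : N 0 = sigma0%:M.
  by rewrite /N /M W0 mul_mx_scalar -scalemxAl QQ scalemx1.
(* The diagonal entries 0, ..., d-1 are pairwise distinct, so only diagonal matrices commute with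
   [E]. *)
pose E : 'M[R]_d := diag_mx (\row_i (val i)%:R).
pose C t := E *m N t - N t *m E.
have Ea : E *m a = a *m E.
  have /diag_mxP[s Ss] := diagS.
  by rewrite /a -scalemxAl -scalemxAr /S Ss diag_mxC.
pose A t := a - N t.
have C0 : C 0 = 0 by rewrite /C N0 scalar_mxC subrr.
have dC (t : R) : 0 < t -> is_derive t 1 C (A t *m C t + C t *m A t).
  move=> t0; have dNt := dN t t0.
  have h := is_deriveB
    (is_derive_mulmx (is_derive_cst E t 1) dNt)
    (is_derive_mulmx dNt (is_derive_cst E t 1)).
  apply: (is_derive_eq h); rewrite mul0mx add0r mulmx0 addr0 /A /C.
  exact: commutator_riccati.
have mxB (X Y : 'M[R]_d) i j : (X - Y) i j = X i j - Y i j by rewrite !mxE.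
have diagN t : 0 <= t -> is_diag_mx (N t).
  move=> t0; have Ct0 : C t = 0.
    move: t0; rewrite le_eqVlt => /predU1P[<-//|t0].
    apply: (@sylvester_ode_eq0 _ _ A C t (ltW t0) dC) => // i j.
      rewrite /C mxB; under eq_fun do rewrite mxB.
      by apply: cvgB; apply: cvg_mulmx_entries => // *; exact: cvg_cst.
    (* Positive times get continuity from differentiability; at 0 it comes from the right limit
       [cN]. *)
    have cNs (s : R) : 0 < s -> A x i j @[x --> s] --> A s i j.
      move=> s0; have /is_derive_mxP/(_ i j) dNij := dN s s0.
      rewrite /A mxB; under eq_fun do rewrite mxB.
      apply: cvgB; first exact: cvg_cst.
      apply: (@differentiable_continuous _ _ _ s (fun x => N x i j)).
      apply/derivable1_diffP.
      exact: (@ex_derive _ _ _ _ _ _ _ dNij).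
    apply/continuous_within_itvP => //; split.
    - by move=> s; rewrite in_itv /= => /andP[s0 _]; exact: cNs.
    - rewrite /A mxB; under eq_fun do rewrite mxB.
      by apply: cvgB => //; exact: cvg_cst.
    - by apply: cvg_at_left_filter; exact: cNs.
  apply/is_diag_mxP => i j ij.
  have CE : C t i j = (i%:R - j%:R) * N t i j.
    rewrite /C mxB mul_diag_mx mul_mx_diag.
    by move: (N t) => X; rewrite !mxE; ring.
  move/eqP: CE; rewrite Ct0 mxE eq_sym mulf_eq0 => /orP[|/eqP//].
  by rewrite subr_eq0 eqr_nat (negbTE ij).
exists Q; split => //; split => //; split => // i t t0.
have /is_derive_mxP/(_ i i) := dN t t0.
have /diag_mxP[n Nn] := diagN t (ltW t0).
have /diag_mxP[s Ss] := diagS.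
move/is_derive_eq; apply.
(* With [S] and [N t] both diagonal, the two halves of [s n] add up and the entry is
   [s n - n^2 = n (s - n)]. *)
rewrite -/(M t) -/(N t) -/Ms /a /S Ss Nn -scalemxAl -scalemxAr !mulmx_diag.
by rewrite !mxE eqxx !mulr1n; field.
Qed.
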